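(* Let $k$ be a fixed positive integer. There exists a constant $n_0(k)$ such that the following holds. If $n\geq n_0(k)$, $t$ is an integer, and $S\subseteq \mathcal{P}(n)$ has cardinality at least \[\sum_{r=0}^{k-1}\binom{n}{\left\lceil \frac{n-k+1 +2r}{2}\right\rceil} + t,\] then \[\mathrm{comp}(S)\geq t\binom{\left\lceil (n+k)/2\right\rceil}{k}.\]
   Context: $\mathcal{P}(n)$ is the boolean lattice: the set of all subsets of $[n]=\{1,\dots,n\}$ ordered by inclusion. For $S\subseteq \mathcal{P}(n)$, $\mathrm{comp}(S)$ is the number of unordered pairs of distinct comparable elements of $S$. *)

(* Defs.v *)
From HB Require Import structures.
From mathcomp Require Import all_boot all_order all_algebra.
Set Implicit Arguments. Unset Strict Implicit. Unset Printing Implicit Defensive.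

Definition ncomp (n : nat) (S : {set {set 'I_n}}) : nat :=
  #|[set P : {set {set 'I_n}} |
      [&& P \subset S, #|P| == 2 &
          [forall A in P, forall B in P, (A \subset B) || (B \subset A)]]]|.

(* Main.v *)
(** Let c = C(ceil((n+k)/2), k) and let M be the sum of the k middle binomials; the
    claim is c |S| <= comp(S) + c M.  A set of S comparable to at least c others is
    removed by induction, so all degrees may be assumed smaller than c.

    Take a uniformly random maximal chain and give its segment between the levels j
    and n - j the weight C(n,j) - C(n,j-1), for every j <= n/2.  Every set then has
    total expected weight 1, and the k middle layers contribute M.  A segment
    meeting S in x sets contains at least x - k pairs of S whose sizes differ by at
    least k, and a pair A < B with k <= |A|, |B| <= n - k and |B| - |A| >= k has
    expected weight at most 1/c.  This settles the case where S has no set of size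
    < k or > n - k.

    Otherwise S has, up to complementation, a set A of size < k.  As A has degree
    < c, the segments starting at level 2k above A nearly all avoid S; each of
    them has slack at least one in the count above.  Their total weight is of order
    at least n^(k+1), while only O(n^k) sets have size < k or > n - k, so discarding
    these sets is paid for. *)
Require Import Defs.
From HB Require Import structures.
From mathcomp Require Import all_boot all_order all_algebra all_fingroup.
From mathcomp Require Import zify.
Set Implicit Arguments. Unset Strict Implicit. Unset Printing Implicit Defensive.

(** * Maximal chains and flags *)

Section Levels.

Variable n : nat.
Implicit Types (s t : {perm 'I_n}) (A B : {set 'I_n}).

(* A permutation encodes a maximal chain through its levels [0], ..., [n]. *)
Definition level s (i : nat) : {set 'I_n} := [set x | s x < i].

Lemma card_level s i : i <= n -> #|level s i| = i.
Proof.
move=> le_in; rewrite -sum1_card; transitivity (\sum_(y < n | y < i) 1).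
  by rewrite [RHS](reindex_inj (@perm_inj _ s)); apply: eq_bigl => x; rewrite inE.
by rewrite -(big_ord_widen n (fun=> 1)) // sum1_card card_ord.
Qed.

Lemma level_subset s i j : i <= j -> level s i \subset level s j.
Proof. by move=> le_ij; apply/subsetP=> x; rewrite !inE => /leq_trans; apply. Qed.

(** List [A], then [B :\: A], then [~: B]; positions in this list form the permutation. *)
Lemma level_flag_exists A B : A \subset B ->
  exists s, level s #|A| = A /\ level s #|B| = B.
Proof.
move=> sAB; pose e := enum A ++ enum (B :\: A) ++ enum (~: B).
have e_all x : x \in e.
  by rewrite !mem_cat !mem_enum !inE; case: (x \in A); case: (x \in B).
have size_e : size e = n.
  rewrite !size_cat -!cardE cardsD (setIidPr sAB).
  by have := subset_leq_card sAB; have := cardsC B; rewrite card_ord; lia.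
have lt_e x : index x e < n by rewrite -[X in _ < X]size_e index_mem.
have inj_e : injective (fun x => Ordinal (lt_e x)).
  move=> x y [/(congr1 (nth x e))].
  by rewrite !nth_index.
exists (perm inj_e); split; apply/setP=> x; rewrite inE permE /= !index_cat.
  rewrite !mem_enum; case: (boolP (x \in A)) => xA.
    by rewrite cardE index_mem mem_enum.
  by apply/negbTE; rewrite -leqNgt cardE leq_addr.
rewrite !mem_enum !inE; case: (boolP (x \in A)) => xA /=.
  rewrite (subsetP sAB) //; apply: leq_trans (subset_leq_card sAB).
  by rewrite cardE index_mem mem_enum.
have cB : #|B| = size (enum A) + size (enum (B :\: A)).
  rewrite -!cardE cardsD (setIidPr sAB).
  by have := subset_leq_card sAB; lia.
case: (boolP (x \in B)) => xB.
  by rewrite cB ltn_add2l index_mem mem_enum !inE xA.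
by apply/negbTE; rewrite -leqNgt cB leq_add2l leq_addr.
Qed.

Definition flags A B := [set s | (level s #|A| == A) && (level s #|B| == B)].

(** Left multiplication by [t], which carries [A'] onto [A] and [B'] onto [B], injects the first set
    of flags into the second. *)
Lemma card_flags_eq A B A' B' : A \subset B -> A' \subset B' ->
  #|A| = #|A'| -> #|B| = #|B'| -> #|flags A B| <= #|flags A' B'|.
Proof.
move=> sAB sAB' cA cB.
have [u [uA uB]] := level_flag_exists sAB.
have [v [vA vB]] := level_flag_exists sAB'.
pose t := (v * u^-1)%g.
rewrite -(card_imset _ (mulgI t)); apply/subset_leq_card/subsetP=> _ /imsetP[s + ->].
rewrite !inE => /andP[/eqP sA /eqP sB]; rewrite -cA -cB.
apply/andP; split; apply/eqP/setP=> x; rewrite inE permM.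
  have -> : (s (t x) < #|A|) = (t x \in A) by rewrite -[in RHS]sA inE.
  by rewrite -[in LHS]uA inE /t permM permKV -[in RHS]vA inE cA.
have -> : (s (t x) < #|B|) = (t x \in B) by rewrite -[in RHS]sB inE.
by rewrite -[in LHS]uB inE /t permM permKV -[in RHS]vB inE cB.
Qed.

Lemma card_nested_pairs a b :
  #|[set p : {set 'I_n} * {set 'I_n} |
     [&& p.1 \subset p.2, #|p.1| == a & #|p.2| == b]]| = 'C(n, b) * 'C(b, a).
Proof.
rewrite -sum1_card (partition_big (fun p => p.2) (fun B => #|B| == b)) /=; last first.
  by move=> p; rewrite inE => /and3P[].
have -> : 'C(n, b) = #|[set B : {set 'I_n} | #|B| == b]|.
  by rewrite card_draws card_ord.
rewrite -sum_nat_const; apply: eq_big => [B|B /eqP cB]; first by rewrite inE.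
rewrite -{2}cB -cards_draws -sum1_card.
rewrite (reindex_onto (fun A => (A, B)) (fun p => p.1)) /=; last first.
  by case=> A B' /andP[_ /eqP <-].
by apply: eq_bigl => A; rewrite !inE /= cB !eqxx !andbT.
Qed.

(** The flags of all nested pairs of these two sizes partition the permutations, into classes of
    equal size by symmetry. *)
Lemma card_flags A B : A \subset B ->
  #|flags A B| * ('C(n, #|B|) * 'C(#|B|, #|A|)) = n`!.
Proof.
move=> sAB; rewrite -card_nested_pairs mulnC -sum_nat_const.
rewrite -card_Sn -[RHS]sum1_card.
pose f s := (level s #|A|, level s #|B|).
have leA s : #|level s #|A| | = #|A|.
  by rewrite card_level // -[X in _ <= X]card_ord max_card.
have leB s : #|level s #|B| | = #|B|.
  by rewrite card_level // -[X in _ <= X]card_ord max_card.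
rewrite [RHS](partition_big f (fun p => [&& p.1 \subset p.2, #|p.1| == #|A| & #|p.2| == #|B|])) /=; last first.
  by move=> s _; rewrite leA leB !eqxx level_subset ?subset_leq_card.
apply: eq_big => [[A' B']|[A' B']]; first by rewrite inE.
rewrite !inE /= => /and3P[sAB' /eqP cA /eqP cB].
have -> : #|flags A B| = #|flags A' B'|.
  by apply/eqP; rewrite eqn_leq !card_flags_eq.
rewrite -sum1_card; apply: eq_bigl => s.
by rewrite /f !inE xpair_eqE cA cB.
Qed.
End Levels.

(** * Layer weights *)

(** In C(b,a) C(a,k) = C(b,k) C(b-k,a-k), the factor C(a,k) = C(a,a-k) is at most C(b-k,a-k). *)
Lemma leq_bin_mid k a b : k <= a -> a + k <= b -> 'C(b, k) <= 'C(b, a).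
Proof.
move=> le_ka le_akb.
have lt0 : 0 < 'C(a, k) by rewrite bin_gt0.
rewrite -(leq_pmul2r lt0).
suff -> : 'C(b, a) * 'C(a, k) = 'C(b, k) * 'C(b - k, a - k).
  rewrite leq_mul2l; apply/orP; right.
  by rewrite -[X in X <= _]bin_sub // leq_bin2l //; lia.
have e1 : 'C(b, a) * (a`! * (b - a)`!) = b`! by rewrite bin_fact //; lia.
have e2 : 'C(a, k) * (k`! * (a - k)`!) = a`! by rewrite bin_fact //; lia.
have e3 : 'C(b, k) * (k`! * (b - k)`!) = b`! by rewrite bin_fact //; lia.
have e4 : 'C(b - k, a - k) * ((a - k)`! * (b - k - (a - k))`!) = (b - k)`!.
  by rewrite bin_fact //; lia.
have e5 : b - k - (a - k) = b - a by lia.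
have gt0 : 0 < k`! * (a - k)`! * (b - a)`! by rewrite !muln_gt0 !fact_gt0.
apply/eqP; rewrite -(eqn_pmul2r gt0); apply/eqP.
move: e1; rewrite -e2 -e3 -e4 e5 => e1.
transitivity ('C(b, a) * ('C(a, k) * (k`! * (a - k)`!) * (b - a)`!)); first by lia.
by rewrite e1; lia.
Qed.

Section LayerWeight.

Variable n : nat.

(* The number of chains starting at level [j] in a symmetric chain
   decomposition of the boolean lattice. *)
Definition layer_weight j := 'C(n, j) - (if j is i.+1 then 'C(n, i) else 0).

Lemma sum_layer_weight p :
  p <= n./2 -> \sum_(j < n./2.+1) layer_weight j * (j <= p) = 'C(n, p).
Proof.
move=> le_p.
have -> : \sum_(j < n./2.+1) layer_weight j * (j <= p) = \sum_(j < p.+1) layer_weight j.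
  rewrite (big_ord_widen n./2.+1 layer_weight) // big_mkcond [RHS]big_mkcond /=.
  by apply: eq_bigr => j _; rewrite ltnS; case: leqP => _; rewrite ?muln1 ?muln0.
elim: p le_p => [|p IHp] le_p; first by rewrite big_ord1 /layer_weight subn0.
rewrite big_ord_recr /= IHp; last by lia.
(* Binomials increase up to the middle, so the truncated subtraction is exact and the sum
   telescopes. *)
by rewrite /layer_weight subnKC // leq_bin_mid //; lia.
Qed.

Lemma leq_layer_weight j : layer_weight j <= 'C(n, j).
Proof. exact: leq_subr. Qed.

(** In this range each binomial is at least twice its predecessor. *)
Lemma layer_weight_ge_half j : 3 * j <= n.+1 -> 'C(n, j) <= 2 * layer_weight j.
Proof.
case: j => [|j] le_jn; first by rewrite /layer_weight; lia.
have := mul_bin_left n j; rewrite /layer_weight => e.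
have : 2 * 'C(n, j) <= 'C(n, j.+1).
  rewrite -(leq_pmul2l (ltn0Sn j)) e mulnA leq_mul2r; apply/orP; right; lia.
lia.
Qed.

End LayerWeight.

(** * Chains through or above a given set *)

Section LevelCounts.

Variable n : nat.
Implicit Types (s : {perm 'I_n}) (A B : {set 'I_n}).

Lemma card_eq_level B : #|[set s | level s #|B| == B]| * 'C(n, #|B|) = n`!.
Proof.
rewrite -(card_flags (sub0set B)) cards0 bin0 muln1; congr (#|pred_of_set _| * _).
apply/setP=> s; rewrite !inE; suff -> : level s #|@set0 'I_n| == set0 by [].
by apply/eqP/setP=> x; rewrite !inE cards0.
Qed.

Lemma card_supersets A j :
  #|A| <= j <= n -> #|[set B : {set 'I_n} | A \subset B & #|B| == j]| = 'C(n - #|A|, j - #|A|).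
Proof.
case/andP=> le_Aj le_jn; have cCA : #|~: A| = n - #|A| by rewrite cardsCs setCK card_ord.
rewrite -bin_sub; last by lia.
have -> : n - #|A| - (j - #|A|) = n - j by lia.
rewrite -cCA -cards_draws -(card_imset _ (@setC_inj _)).
apply: eq_card => B; rewrite !inE; apply/imsetP/andP => [[D + ->]|[sBA /eqP cB]].
  rewrite inE => /andP[sAD /eqP cD]; rewrite setCS sAD; split=> //.
  by rewrite cardsCs setCK card_ord cD.
exists (~: B); last by rewrite setCK.
by rewrite inE subsetC sBA cardsCs setCK card_ord cB; apply/eqP; lia.
Qed.

Lemma card_subset_level A j : #|A| <= j <= n ->
  #|[set s | A \subset level s j]| * 'C(n, j) = n`! * 'C(n - #|A|, j - #|A|).
Proof.
move=> A_j; have /andP[le_Aj le_jn] := A_j.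
rewrite -card_supersets // -sum1_card.
rewrite (partition_big (fun s => level s j) (fun B => (A \subset B) && (#|B| == j))) /=; last first.
  by move=> s; rewrite inE => ->; rewrite card_level // eqxx.
rewrite big_distrl /= mulnC -sum_nat_const.
apply: eq_big => [B|B /andP[sAB /eqP cB]]; first by rewrite inE.
rewrite sum1dep_card -(card_eq_level B) cB; congr (_ * _).
apply: eq_card => s; rewrite !inE.
by case: eqP => [->|_]; rewrite ?sAB ?andbF.
Qed.

End LevelCounts.

(** * The weighted chain inequality *)

Lemma sum_window L k a b :
  \sum_(r < k) (a <= L + r < b) = minn b (L + k) - maxn a L.
Proof.
elim: k => [|k IHk]; first by rewrite big_ord0; lia.
by rewrite big_ord_recr /= IHk; lia.
Qed.

Section Segment.

Variables n k : nat.

Definition segment_card j (f : pred nat) :=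
  \sum_(i < n.+1) ((j <= i <= n - j) && f i).

Definition segment_far_pairs j (f : pred nat) :=
  \sum_(a < n.+1) \sum_(b < n.+1)
     [&& j <= a, b <= n - j, a + k <= b, f a & f b].

(** The start of the window is the ceiling of (n-k+1)/2, the lowest of the k middle levels. *)
Definition segment_middle j :=
  \sum_(r < k) (j <= (n + 1 - k).+1 %/ 2 + r <= n - j).

(* In a segment of a chain, all points of [f] but those in a window of length
   [k] starting at the first one have a point of [f] at least [k] below. *)
Lemma leq_segment_card j f : 0 < k <= n -> j <= n./2 ->
  segment_card j f + (segment_card j f == 0)
    <= segment_far_pairs j f + segment_middle j.
Proof.
move=> /andP[k_gt0 le_kn] le_jn; set X := segment_card j f.
have le_X_len : X <= n.+1 - j.*2.
  apply: (@leq_trans (\sum_(i < n.+1) (j <= 0 + i < (n - j).+1))).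
    by apply: leq_sum => i _; rewrite add0n ltnS; case: (f i); rewrite ?andbT ?andbF.
  by rewrite sum_window; lia.
(* The middle window is centred up to rounding, so it lies inside the segment or covers it. In
   particular this count is positive, which gives the slack when [X] is 0. *)
have le_Q : minn k (n.+1 - j.*2) <= segment_middle j.
  by rewrite /segment_middle (sum_window _ k j (n - j).+1); lia.
case: (posnP X) => [X0|X_gt0]; first by rewrite X0; lia.
suff le_X : X <= segment_far_pairs j f + k.
  by move: le_X le_X_len le_Q; lia.
have exi : exists i, [&& j <= i, i <= n - j & f i].
  move: X_gt0; rewrite lt0n sum_nat_eq0 negb_forall => /existsP[i].
  by rewrite eqb0 negbK -andbA => fi; exists i.
case: (ex_minnP exi) => m /and3P[le_jm le_mj fm] min_m.
have lt_mn : m < n.+1 by lia.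
rewrite /segment_far_pairs (bigD1 (Ordinal lt_mn)) //= addnAC.
apply: leq_trans (leq_addr _ _).
have le_k : \sum_(i < n.+1) (m <= 0 + i < m + k) <= k by rewrite sum_window; lia.
apply: leq_trans (leq_add (leqnn _) le_k).
rewrite -big_split /=; apply: leq_sum => i _; rewrite add0n.
case: (boolP [&& j <= i, i <= n - j & f i]) => [/[dup] /min_m le_mi|].
  by case/and3P=> -> -> ->; rewrite le_jm fm /=; lia.
by rewrite -andbA => /negbTE ->.
Qed.

End Segment.

Lemma card_set_sum (T : finType) (P : pred T) : #|[set x | P x]| = \sum_x P x.
Proof. by rewrite -sum1dep_card big_mkcond; apply: eq_bigr => x _; case: (P x). Qed.

Section ChainInequality.

Variables n k : nat.
Implicit Types (s : {perm 'I_n}) (A B : {set 'I_n}) (S : {set {set 'I_n}}).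

Definition on_chain S s : pred nat := fun i => level s i \in S.

Definition comparable_pairs S :=
  [set p : {set 'I_n} * {set 'I_n} | [&& p.1 \in S, p.2 \in S & p.1 \proper p.2]].

Lemma leq_card_ord A : #|A| <= n.
Proof. by rewrite -[X in _ <= X]card_ord max_card. Qed.

Lemma sum_on_chain S s (g : nat -> nat) :
  \sum_(i < n.+1) on_chain S s i * g i =
  \sum_(B in S) (level s #|B| == B) * g #|B|.
Proof.
transitivity (\sum_(i < n.+1) \sum_(B in S) (level s i == B) * g i).
  apply: eq_bigr => i _; rewrite -big_distrl /=; congr (_ * _).
  rewrite /on_chain; case: (boolP (level s i \in S)) => lS.
    rewrite (bigD1 (level s i)) //= eqxx big1 // => B /andP[_ /negbTE].
    by rewrite eq_sym => ->.
  by rewrite big1 // => B BS; case: eqP => // e; rewrite e BS in lS.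
rewrite exchange_big; apply: eq_bigr => B _ /=.
have ltBn : #|B| < n.+1 by rewrite ltnS leq_card_ord.
rewrite (bigD1 (Ordinal ltBn)) //= big1 ?addn0 // => i ne_i.
case: eqP => // def_B; case/negP: ne_i; rewrite -val_eqE /= -def_B.
by rewrite card_level // -ltnS.
Qed.

(** The segments containing levels a and b are those with j <= min(a, n-b), so the weights
    telescope. *)
Lemma sum_weight_segment a b : a <= b <= n ->
  \sum_(j < n./2.+1) layer_weight n j * ((j <= a) && (b <= n - j))
    = 'C(n, minn a (n - b)).
Proof.
move=> ab; rewrite -sum_layer_weight; last by lia.
by apply: eq_bigr => j _; congr (_ * _); congr nat_of_bool; have := ltn_ord j; lia.
Qed.

(** The segments through level i weigh C(n,i) in all, cancelling the proportion 1/C(n,i) of chains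
    through a given set of that level. Sums over permutations replace expectations, hence the factor
    n!. *)
Lemma sum_weight_segment_card S :
  \sum_(j < n./2.+1) \sum_s layer_weight n j * segment_card n j (on_chain S s)
    = n`! * #|S|.
Proof.
transitivity (\sum_s \sum_(i < n.+1) on_chain S s i * 'C(n, i)).
  rewrite exchange_big; apply: eq_bigr => s _ /=.
  under eq_bigr => j _ do rewrite /segment_card big_distrr /=.
  rewrite exchange_big; apply: eq_bigr => i _ /=.
  have le_in : i <= n by rewrite -ltnS.
  have -> : 'C(n, i) = 'C(n, minn i (n - i)).
    by case: leqP => // _; rewrite bin_sub.
  rewrite -sum_weight_segment; last by rewrite leqnn.
  rewrite big_distrr /=; apply: eq_bigr => j _.
  by rewrite mulnCA; case: (on_chain S s i); rewrite ?andbT ?andbF ?mul1n // muln0.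
under eq_bigr => s _ do rewrite sum_on_chain.
rewrite exchange_big mulnC -sum_nat_const; apply: eq_bigr => B _ /=.
by rewrite -big_distrl /= -(card_eq_level B) card_set_sum.
Qed.

(* The total weight of the segments through a flag of levels [a <= b], divided by
   the number of such flags, is at most one over the target constant. *)
Lemma leq_bin_flag a b : k <= a -> a + k <= b -> b + k <= n ->
  'C((n + k).+1 %/ 2, k) * 'C(n, minn a (n - b)) <= 'C(n, b) * 'C(b, a).
Proof.
move=> le_ka le_akb le_bkn; case: (leqP a (n - b)) => le_ab.
  have -> : 'C(n, b) * 'C(b, a) = 'C(n - a, b - a) * 'C(n, a).
    have e1 : 'C(n, b) * (b`! * (n - b)`!) = n`! by rewrite bin_fact //; lia.
    have e2 : 'C(b, a) * (a`! * (b - a)`!) = b`! by rewrite bin_fact //; lia.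
    have e3 : 'C(n, a) * (a`! * (n - a)`!) = n`! by rewrite bin_fact //; lia.
    have e4 : 'C(n - a, b - a) * ((b - a)`! * (n - b)`!) = (n - a)`!.
      have -> : n - b = n - a - (b - a) by lia.
      by rewrite bin_fact //; lia.
    have gt0 : 0 < a`! * (b - a)`! * (n - b)`! by rewrite !muln_gt0 !fact_gt0.
    apply/eqP; rewrite -(eqn_pmul2r gt0); apply/eqP; move: e1; rewrite -e2 -e3 -e4; lia.
  rewrite leq_mul2r; apply/orP; right.
  apply: (@leq_trans 'C(n - a, k)); first by apply: leq_bin2l; lia.
  by apply: leq_bin_mid; lia.
rewrite bin_sub; last by lia.
rewrite mulnC leq_mul2l; apply/orP; right.
apply: (@leq_trans 'C(b, k)); first by apply: leq_bin2l; lia.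
exact: leq_bin_mid.
Qed.

Lemma sum_weight_far_pairs S : {in S, forall A, k <= #|A| <= n - k} -> 2 * k <= n -> 0 < k ->
  'C((n + k).+1 %/ 2, k) *
    (\sum_(j < n./2.+1) \sum_s layer_weight n j * segment_far_pairs n k j (on_chain S s))
  <= n`! * #|comparable_pairs S|.
Proof.
move=> midS le_kn k_gt0.
(* For levels at least k apart, this is the total weight of the segments containing both. *)
pose g a b := (a + k <= b) * 'C(n, minn a (n - b)).
have -> : \sum_(j < n./2.+1) \sum_s layer_weight n j * segment_far_pairs n k j (on_chain S s)
  = \sum_(A in S) \sum_(B in S) #|flags A B| * g #|A| #|B|.
  transitivity (\sum_s \sum_(a < n.+1) on_chain S s a * \sum_(b < n.+1) on_chain S s b * g a b).
    rewrite exchange_big; apply: eq_bigr => s _ /=.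
    under eq_bigr => j _ do rewrite /segment_far_pairs big_distrr /=.
    rewrite exchange_big; apply: eq_bigr => a _ /=.
    under eq_bigr => j _ do rewrite big_distrr /=.
    rewrite exchange_big big_distrr; apply: eq_bigr => b _ /=; rewrite /g.
    case: (leqP (a + k) b) => [le_akb|_]; last first.
      by rewrite mul0n !muln0 big1 // => j _; rewrite !andbF muln0.
    rewrite -sum_weight_segment; last by have := ltn_ord b; lia.
    rewrite mul1n mulnA big_distrr; apply: eq_bigr => j _ /=.
    rewrite [in RHS]mulnCA; congr (_ * _).
    rewrite !mulnb; congr nat_of_bool;
    by case: (on_chain S s a); case: (on_chain S s b); rewrite ?andbF ?andbT.
  under eq_bigr => s _ do rewrite (sum_on_chain S s
    (fun a => \sum_(b < n.+1) on_chain S s b * g a b)).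
  rewrite exchange_big; apply: eq_bigr => A _ /=.
  under eq_bigr => s _ do rewrite (sum_on_chain S s (g #|A|)) big_distrr /=.
  rewrite exchange_big; apply: eq_bigr => B _ /=.
  under eq_bigr => s _ do rewrite mulnA mulnb.
  by rewrite -big_distrl /= card_set_sum.
have -> : #|comparable_pairs S| = \sum_(A in S) \sum_(B in S) (A \proper B).
  rewrite pair_big_dep /= card_set_sum [RHS]big_mkcond /=.
  by apply: eq_bigr => -[A B] _ /=; case: (A \in S); case: (B \in S).
rewrite !big_distrr; apply: leq_sum => A /midS/andP[leA1 leA2] /=.
rewrite !big_distrr; apply: leq_sum => B /midS/andP[leB1 leB2] /=.
rewrite /g; case: (leqP (#|A| + k) #|B|) => le_AkB; last by rewrite mul0n !muln0.
rewrite mul1n.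
have [sAB|nsAB] := boolP (A \subset B); last first.
  suff -> : #|flags A B| = 0 by rewrite mul0n muln0.
  apply/eqP; rewrite cards_eq0 -subset0; apply/subsetP=> s; rewrite inE => /andP[/eqP sA /eqP sB].
  by case/negP: nsAB; rewrite -sA -sB level_subset //; lia.
have -> : A \proper B by rewrite properEcard sAB; lia.
rewrite muln1 -(card_flags sAB) mulnCA leq_mul2l; apply/orP; right.
apply: leq_bin_flag => //; apply: leq_trans (leq_add leB2 (leqnn k)) _; lia.
Qed.

Lemma sum_weight_middle : k <= n ->
  \sum_(j < n./2.+1) layer_weight n j * segment_middle n k j
    = \sum_(r < k) 'C(n, (n + 1 - k).+1 %/ 2 + r).
Proof.
move=> le_kn; under eq_bigr => j _ do rewrite /segment_middle big_distrr /=.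
rewrite exchange_big; apply: eq_bigr => r _ /=; set i := (_ + r).
have le_in : i <= n by rewrite /i; have := ltn_ord r; lia.
rewrite sum_weight_segment ?leqnn //.
by case: leqP => // _; rewrite bin_sub.
Qed.

(** The weighted sum of [leq_segment_card] over all segments. The slack of empty segments is kept:
    it later pays for the extremal sets. *)
Lemma chain_inequality S :
  {in S, forall A, k <= #|A| <= n - k} -> 2 * k <= n -> 0 < k ->
  'C((n + k).+1 %/ 2, k) *
    (n`! * #|S| + \sum_(j < n./2.+1) \sum_s layer_weight n j * (segment_card n j (on_chain S s) == 0))
  <= n`! * #|comparable_pairs S|
     + 'C((n + k).+1 %/ 2, k) * (n`! * \sum_(r < k) 'C(n, (n + 1 - k).+1 %/ 2 + r)).
Proof.
move=> midS le_kn k_gt0; apply: leq_trans (leq_add (sum_weight_far_pairs midS le_kn k_gt0) (leqnn _)).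
rewrite -mulnDr leq_mul2l; apply/orP; right.
rewrite -sum_weight_segment_card -sum_weight_middle; last by lia.
rewrite big_distrr -!big_split /=; apply: leq_sum => j _.
rewrite -card_Sn -sum1_card big_distrl -!big_split /=; apply: leq_sum => s _.
rewrite mul1n -!mulnDr leq_mul2l leq_segment_card ?orbT //; have := ltn_ord j; lia.
Qed.

End ChainInequality.

(** * Removing sets of large degree; extremal sets *)

Section ComparablePairs.

Variable n : nat.
Implicit Types (A B : {set 'I_n}) (S : {set {set 'I_n}}).

Definition comparable_to S A := [set B in S | (A \proper B) || (B \proper A)].

Lemma leq_comparable_pairs_ncomp S : #|comparable_pairs S| <= ncomp S.
Proof.
have inj : {in comparable_pairs S &, injective (fun p => [set p.1; p.2])}.
  move=> [A B] [A' B']; rewrite !inE /= => /and3P[_ _ pAB] /and3P[_ _ pAB'] e.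
  have : A \in [set A'; B'] by rewrite -e set21.
  have : B \in [set A'; B'] by rewrite -e set22.
  have : A' \in [set A; B] by rewrite e set21.
  have : B' \in [set A; B] by rewrite e set22.
  rewrite !inE => /orP[]/eqP e1 /orP[]/eqP e2 /orP[]/eqP e3 /orP[]/eqP e4; subst=> //;
    by move: pAB pAB'; rewrite ?properxx // => /proper_sub sAB /proper_subn; rewrite sAB.
rewrite -(card_in_imset inj); apply/subset_leq_card/subsetP=> _ /imsetP[[A B] + ->].
rewrite !inE /= => /and3P[AS BS pAB]; apply/and3P; split.
- by apply/subsetP=> D; rewrite !inE => /orP[]/eqP->.
- by rewrite cards2; move: pAB; rewrite properEneq => /andP[->].
- apply/forall_inP=> X; rewrite !inE => XAB; apply/forall_inP=> Y; rewrite !inE => YAB.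
  have sAB := proper_sub pAB.
  by case/orP: XAB => /eqP->; case/orP: YAB => /eqP->; rewrite ?subxx ?sAB ?orbT.
Qed.

Lemma comparable_pairsD1 S A : A \in S ->
  #|comparable_pairs (S :\ A)| + #|comparable_to S A| <= #|comparable_pairs S|.
Proof.
move=> AS; pose f B := if A \proper B then (A, B) else (B, A).
have inj : {in comparable_to S A &, injective f}.
  move=> B B'; rewrite !inE /f => /andP[_ AB] /andP[_ AB'].
  case: (boolP (A \proper B)) AB => p _; case: (boolP (A \proper B')) AB' => p' _.
  - by case.
  - by case=> _ e; rewrite e properxx in p.
  - by case=> _ e; rewrite -e properxx in p'.
  - by case.
rewrite -(card_in_imset inj).
have /eqP dis : comparable_pairs (S :\ A) :&: f @: comparable_to S A == set0.
  rewrite -subset0; apply/subsetP=> p /setIP[+ /imsetP[B _ def_p]].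
  by rewrite def_p /f !inE; case: ifP; rewrite /= eqxx ?andbF.
rewrite -cardsUI dis cards0 addn0; apply/subset_leq_card/subsetP=> p /setUP[].
  by rewrite !inE => /and3P[/andP[_ ->] /andP[_ ->]].
case/imsetP=> B; rewrite inE => /andP[BS AB] ->; rewrite /f inE.
by case: ifP AB => [-> _|_ /= ->]; rewrite /= AS BS.
Qed.

Lemma comparable_pairsS S S' : S' \subset S -> #|comparable_pairs S'| <= #|comparable_pairs S|.
Proof.
move=> /subsetP sS; apply/subset_leq_card/subsetP=> p; rewrite !inE.
by case/and3P=> /sS-> /sS->.
Qed.

Lemma mem_imset_setC S A : (A \in [set ~: B | B in S]) = (~: A \in S).
Proof. by rewrite -[A in LHS]setCK mem_imset //; apply: setC_inj. Qed.

(** Complementation reverses inclusion; this reduces large sets to small ones. *)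
Lemma comparable_pairs_setC S :
  #|comparable_pairs [set ~: B | B in S]| <= #|comparable_pairs S|.
Proof.
have inj : injective (fun p : {set 'I_n} * {set 'I_n} => (~: p.2, ~: p.1)).
  by move=> [A B] [A' B'] /= [/setC_inj-> /setC_inj->].
rewrite -(card_imset _ inj); apply/subset_leq_card/subsetP=> _ /imsetP[[A B] + ->].
by rewrite !inE !mem_imset_setC /= properC => /and3P[-> ->].
Qed.

Lemma comparable_to_setC S A :
  #|comparable_to [set ~: B | B in S] (~: A)| <= #|comparable_to S A|.
Proof.
rewrite -(card_imset _ (@setC_inj _)); apply/subset_leq_card/subsetP=> _ /imsetP[B + ->].
by rewrite !inE mem_imset_setC (properCr A B) (properCl B A) orbC.
Qed.

End ComparablePairs.

(** * Weight of the segments avoiding the family *)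

Section Deficit.

Variable n : nat.
Implicit Types (s : {perm 'I_n}) (A B : {set 'I_n}) (S : {set {set 'I_n}}).

Definition empty_segments S :=
  \sum_(j < n./2.+1) \sum_(s : {perm 'I_n}) layer_weight n j * (segment_card n j (on_chain S s) == 0).

(* If [A] has few comparable sets, then almost all segments whose bottom contains
   [A] avoid [S]. *)
Lemma empty_segments_lower_bound S S' A j :
  S' \subset S -> #|A| < j -> 3 * j <= n ->
  n`! * 'C(n - #|A|, j - #|A|) <= 2 * (empty_segments S' + n`! * #|comparable_to S A|).
Proof.
move=> /subsetP sS ltAj le_jn.
have A_j : #|A| <= j <= n by lia.
rewrite -card_subset_level //.
have le_lw : 'C(n, j) <= 2 * layer_weight n j by apply: layer_weight_ge_half; lia.
apply: leq_trans (leq_mul (leqnn _) le_lw) _.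
rewrite mulnCA leq_mul2l /=.
have lt_j : j < n./2.+1 by lia.
pose E s := segment_card n j (on_chain S' s) == 0.
apply: (@leq_trans (\sum_s layer_weight n j * E s + n`! * #|comparable_to S A|)); last first.
  by rewrite leq_add2r /empty_segments (bigD1 (Ordinal lt_j)) //= leq_addr.
have step s : (A \subset level s j) <=
    E s + \sum_(B in comparable_to S A) ((j <= #|B| <= n - j) && (level s #|B| == B)).
  case: (boolP (A \subset level s j)) => // sAj.
  rewrite /E; case: (posnP (segment_card _ _ _)) => //=.
  rewrite lt0n /segment_card sum_nat_eq0 negb_forall => /existsP[i].
  rewrite eqb0 negbK => /andP[ji iS]; have le_in : i <= n by rewrite -ltnS.
  have ci : #|level s i| = i by rewrite card_level.
  rewrite add0n (bigD1 (level s i)) /=; last first.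
    rewrite inE sS //= properEcard ci (subset_trans sAj) ?level_subset //; lia.
  by rewrite ci eqxx andbT; lia.
rewrite card_set_sum mulnC big_distrr /=.
apply: (@leq_trans (\sum_s layer_weight n j * (E s +
   \sum_(B in comparable_to S A) ((j <= #|B| <= n - j) && (level s #|B| == B))))).
  by apply: leq_sum => s _; rewrite leq_mul2l step orbT.
under eq_bigr => s _ do rewrite mulnDr.
rewrite big_split leq_add2l /=.
rewrite -big_distrr /= exchange_big /= big_distrr /= [X in _ <= X]mulnC -sum_nat_const.
apply: leq_sum => B _; case: (boolP (j <= #|B| <= n - j)) => /= [jB|_]; last first.
  by rewrite big1 ?muln0.
rewrite -(card_eq_level B) card_set_sum mulnC leq_mul2l; apply/orP; right.
have /andP[le_jB le_Bj] := jB.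
(* The weight is at most C(n,j) <= C(n,|B|), so each neighbour costs at most n!. *)
apply: leq_trans (leq_layer_weight _ _) _; apply: leq_bin_mid => //.
by apply: leq_trans (leq_add le_Bj (leqnn j)) _; lia.
Qed.

End Deficit.

(** * How large n must be *)

Section Threshold.

Variable k : nat.

(** The term 6k allows segments starting at level 2k, where 3j <= n is required; the rest makes n -
    2k exceed the factor 2(k+1)(2k+1)2^k of [threshold_bin]. *)
Definition threshold := 6 * k + 2 * (k.+1 * (2 * k).+1 * 2 ^ k) + 1.

Lemma leq_bin_shift n i : 2 * k <= n -> 'C(n + i, k) <= 2 ^ i * 'C(n, k).
Proof.
move=> le_kn; elim: i => [|i IHi]; first by rewrite addn0 mul1n.
rewrite expnS -mulnA; apply: leq_trans (leq_mul (leqnn 2) IHi).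
rewrite addnS; case: (k) le_kn => [|k'] le_kn; first by rewrite !bin0.
rewrite binS mul2n -addnn leq_add2l; apply: leq_bin_mid; lia.
Qed.

(** The right side is at least C(n-k,k+1), which is (n-2k)/(k+1) times C(n-k,k), while C(n,k) <= 2^k
    C(n-k,k). *)
Lemma threshold_bin n a : 0 < k -> threshold <= n -> a < k ->
  2 * ((2 * k).+1 * 'C(n, k)) <= 'C(n - a, 2 * k - a).
Proof.
rewrite /threshold => k_gt0 le_n lt_ak.
have le1 : 'C(n - k, k.+1) <= 'C(n - a, 2 * k - a).
  apply: (@leq_trans 'C(n - a, k.+1)); first by apply: leq_bin2l; lia.
  by apply: leq_bin_mid; lia.
apply: leq_trans le1; rewrite -(leq_pmul2l (ltn0Sn k)) mul_bin_left.
have := @leq_bin_shift (n - k) k; rewrite subnK; last by lia.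
move=> /(_ ltac:(lia)) le2.
apply: (@leq_trans (k.+1 * (2 * ((2 * k).+1 * (2 ^ k * 'C(n - k, k)))))).
  by rewrite !leq_mul2l le2 !orbT.
rewrite !mulnA leq_mul2r; apply/orP; right; lia.
Qed.

End Threshold.

(** * Supersaturation for arbitrary families *)

Section Supersaturation.

Variables n k : nat.
Hypotheses (k_gt0 : 0 < k) (le_n : threshold k <= n).
Implicit Types (A B : {set 'I_n}) (S : {set {set 'I_n}}).

Local Notation c := 'C((n + k).+1 %/ 2, k).
Local Notation middle_sum := (\sum_(r < k) 'C(n, (n + 1 - k).+1 %/ 2 + r)).

Let le_kn : 6 * k <= n.
Proof. by move: le_n; rewrite /threshold; lia. Qed.

Definition central S := [set A in S | k <= #|A| <= n - k].

Lemma card_extremal_sets :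
  #|[set A : {set 'I_n} | ~~ (k <= #|A| <= n - k)]| <= 2 * k * 'C(n, k).
Proof.
have small m : m <= k -> #|[set A : {set 'I_n} | #|A| < m]| <= m * 'C(n, k).
  elim: m => [|m IHm] le_mk; first by rewrite leqn0 cards_eq0; apply/eqP/setP=> A; rewrite !inE.
  have -> : [set A : {set 'I_n} | #|A| < m.+1]
      = [set A : {set 'I_n} | #|A| == m] :|: [set A : {set 'I_n} | #|A| < m].
    by apply/setP=> A; rewrite !inE ltnS leq_eqVlt.
  apply: leq_trans (leq_card_setU _ _) _; rewrite mulSn.
  apply: leq_add; last by apply: IHm; apply: ltnW.
  by rewrite card_draws card_ord; apply: leq_bin_mid; lia.
pose E := [set A : {set 'I_n} | #|A| < k].
apply: (@leq_trans #|E :|: [set ~: A | A in E]|).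
  apply/subset_leq_card/subsetP=> A; rewrite !inE mem_imset_setC inE.
  by rewrite [#|~: A|]cardsCs setCK card_ord; have := leq_card_ord A; lia.
apply: leq_trans (leq_card_setU _ _) _.
rewrite card_imset; last exact: setC_inj.
by rewrite mul2n -addnn mulnDl leq_add // small.
Qed.

Lemma supersaturation_of_empty_segments S :
  n`! * #|S :\: central S| <= empty_segments (central S) ->
  c * #|S| <= #|comparable_pairs S| + c * middle_sum.
Proof.
move=> le_empty.
have sS : central S \subset S by apply/subsetP=> A; rewrite inE => /andP[].
have mid : {in central S, forall A, k <= #|A| <= n - k}.
  by move=> A; rewrite inE => /andP[].
have le_pairs := comparable_pairsS sS.
have := chain_inequality mid; rewrite -/(empty_segments _) => /(_ ltac:(lia) k_gt0) ineq.
rewrite -(leq_pmul2l (fact_gt0 n)) mulnDr.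
rewrite -(cardsID (central S) S) (setIidPr sS).
rewrite mulnCA mulnDr [in X in _ <= _ + X]mulnCA.
apply: leq_trans (leq_mul (leqnn _) (leq_add (leqnn _) le_empty)) _.
apply: leq_trans ineq _.
by rewrite leq_add2r leq_mul2l le_pairs orbT.
Qed.

(** Of the 2k + 1 copies of C(n,k) in [threshold_bin], 2k pay for the extremal sets and one for the
    degree of [A], since c <= C(n,k). *)
Lemma supersaturation_small S A : A \in S -> #|A| < k -> #|comparable_to S A| < c ->
  c * #|S| <= #|comparable_pairs S| + c * middle_sum.
Proof.
move=> AS ltAk lt_deg; apply: supersaturation_of_empty_segments.
have sS : central S \subset S by apply/subsetP=> B; rewrite inE => /andP[].
have := @empty_segments_lower_bound n S (central S) A (2 * k) sS.
move=> /(_ ltac:(lia) ltac:(lia)) bound.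
have le_c : c <= 'C(n, k) by apply: leq_bin2l; lia.
have le_m : #|S :\: central S| <= 2 * k * 'C(n, k).
  apply: leq_trans card_extremal_sets; apply/subset_leq_card/subsetP=> B.
  by rewrite !inE negb_and => /andP[/orP[/negP nB /nB|]].
have := threshold_bin k_gt0 le_n ltAk; rewrite -(leq_pmul2l (fact_gt0 n)) => thr.
have := leq_trans thr bound; rewrite mulnCA leq_pmul2l // => le.
rewrite -(leq_add2r (n`! * #|comparable_to S A|)); apply: leq_trans le.
by rewrite -mulnDr leq_mul2l; apply/orP; right; lia.
Qed.

Lemma supersaturation S : c * #|S| <= #|comparable_pairs S| + c * middle_sum.
Proof.
have [m le_m] := ubnP #|S|; elim: m S le_m => // m IHm S le_m.
(* Removing a set of degree at least c lowers the left side by c and the number of pairs by at least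
   c. *)
have [/existsP[A /andP[AS le_deg]]|] := boolP [exists A, (A \in S) && (c <= #|comparable_to S A|)].
  have := comparable_pairsD1 AS; have := cardsD1 A S; rewrite AS add1n => cS le_pairs.
  have lt_m : #|S :\ A| < m by rewrite -ltnS -cS.
  rewrite cS mulnS (leq_trans (leq_add le_deg (IHm _ lt_m))) // addnA leq_add2r.
  by rewrite addnC (leq_trans _ le_pairs).
rewrite negb_exists => /forallP deg.
have lt_deg A : A \in S -> #|comparable_to S A| < c.
  by move=> AS; have := deg A; rewrite AS ltnNge.
have [/existsP[A /andP[AS ltAk]]|] := boolP [exists A, (A \in S) && (#|A| < k)].
  exact: supersaturation_small (lt_deg A AS).
rewrite negb_exists => /forallP no_small.
have [/existsP[A /andP[AS ltAk]]|] := boolP [exists A, (A \in S) && (n - k < #|A|)].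
  have := @supersaturation_small [set ~: B | B in S] (~: A).
  rewrite mem_imset_setC setCK card_imset; last exact: setC_inj.
  have cCA : #|~: A| = n - #|A| by rewrite cardsCs setCK card_ord.
  have := leq_card_ord A; rewrite cCA => leAn /(_ AS ltac:(lia)).
  move=> /(_ (leq_ltn_trans (comparable_to_setC S A) (lt_deg A AS))) le.
  by apply: leq_trans le _; rewrite leq_add2r comparable_pairs_setC.
rewrite negb_exists => /forallP no_large.
apply: supersaturation_of_empty_segments.
(* Without extremal sets nothing is discarded, so no empty segment is needed. *)
have -> : central S = S.
  apply/setP=> A; rewrite inE andb_idr // => AS.
  by have := no_small A; have := no_large A; rewrite AS /= -!leqNgt => -> ->.
by rewrite setDv cards0 muln0.
Qed.

End Supersaturation.

Import Order.TTheory GRing.Theory Num.Theory.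
Local Open Scope ring_scope.

Theorem mainTheorem8 (k : nat) : (0 < k)%N ->
  exists n0 : nat, forall n : nat, (n0 <= n)%N ->
  forall (t : int) (S : {set {set 'I_n}}),
    (\sum_(r < k) 'C(n, ((n + 1 + 2 * r - k).+1 %/ 2)%N))%N%:Z + t <= (#|S|)%:Z ->
    t * ('C(((n + k).+1 %/ 2)%N, k))%:Z <= (ncomp S)%:Z.
Proof.
move=> k_gt0; exists (threshold k) => n le_n t S le_S.
have := supersaturation k_gt0 le_n S; have := leq_comparable_pairs_ncomp S.
set c := 'C(_, k); set M := (\sum_(r < k) _)%N => le_pairs le_c.
(* The shift 2r leaves the ceiling as r; k <= n keeps the truncated subtractions exact. *)
have eM : (\sum_(r < k) 'C(n, ((n + 1 + 2 * r - k).+1 %/ 2)%N))%N = M.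
  have le_kn : (k <= n)%N by move: le_n; rewrite /threshold; lia.
  by apply: eq_bigr => r _; congr 'C(n, _); lia.
move: le_S; rewrite eM => le_S.
(* As c >= 0, this also covers negative t. *)
have : t * c%:Z <= (#|S|%:Z - M%:Z) * c%:Z.
  by apply: ler_wpM2r => //; lia.
move=> /le_trans; apply; move: le_c le_pairs; nia.
Qed.
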